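(* Let $\rho=|\psi\rangle\langle\psi|$ be an $n$-qubit pure state, $S\subseteq[n]$ non-empty with $s=|S|$, $\epsilon>0$ and $1-\delta\in(0,1)$. Let $N_B=\lceil 8\log(1/\delta)\rceil$, $B=\lceil 4(3/2)^s\epsilon^{-2}\rceil$ and $L=N_BB$. Sample independent random local unitaries $U_1,\dots,U_L$, each $U_l=\bigotimes_{i\in S}U_{l,i}$ with independent Haar-random $U_{l,i}\in U(2)$, and for each $l$ obtain two outcomes $\mathbf{Z}_{l,1},\mathbf{Z}_{l,2}\in\{0,1\}^s$ which, conditioned on $U_l$, are independent with distribution $P_{U_l}(\mathbf{z})=\operatorname{tr}\big(U_l\rho U_l^\dagger(|\mathbf{z}\rangle\langle\mathbf{z}|\otimes\mathbb{I}_{[n]\setminus S})\big)$. For each $1\le b\le N_B$ define $$\overline{\mathcal{C}}^{(b)}_{|\psi\rangle}(S)=1-\Big(\tfrac32\Big)^s\frac1B\sum_{l=(b-1)B+1}^{bB}\mathbb{1}[\mathbf{Z}_{l,1}=\mathbf{Z}_{l,2}].$$ Then $$\Pr\Big[\big|\operatorname{median}\big(\overline{\mathcal{C}}^{(1)}_{|\psi\rangle}(S),\dots,\overline{\mathcal{C}}^{(N_B)}_{|\psi\rangle}(S)\big)-\mathcal{C}_{|\psi\rangle}(S)\big|\ge\epsilon\Big]\le\delta,$$ so that $O\big((3/2)^s\log(1/\delta)\epsilon^{-2}\big)$ measurement outcomes suffice.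
   Context: $[n]=\{1,\dots,n\}$ labels the qubits. For an $n$-qubit pure state $|\psi\rangle$ and a non-empty $S\subseteq[n]$ with $s=|S|$, the concentratable entanglement is $\mathcal{C}_{|\psi\rangle}(S)=1-\frac{1}{2^s}\sum_{\alpha\subseteq S}\operatorname{tr}(\rho_\alpha^2)$, where $\rho_\alpha$ is the reduced state of $|\psi\rangle\langle\psi|$ on the qubits in $\alpha$, and $\operatorname{tr}(\rho_\emptyset^2):=1$. $\mathbb{1}[A]$ is $1$ if $A$ holds and $0$ otherwise. *)

(* Defs.v *)
From mathcomp Require Import all_boot all_algebra complex.
From mathcomp Require Import all_classical all_reals all_analysis.
Import GRing.Theory Num.Theory.

Set Implicit Arguments.
Unset Strict Implicit.
Unset Printing Implicit Defensive.

Local Open Scope ring_scope.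

Definition config (n : nat) := {ffun 'I_n -> bool}.

Section Quantum.
Variable R : realType.
Local Notation C := R[i].
Variable n : nat.

(* configurations vanishing outside A: canonical representatives of the
   computational basis of the qubits in A *)
Definition supported (A : {set 'I_n}) : {set config n} :=
  [set x : config n | [forall i, (i \notin A) ==> ~~ x i]].

Definition glue (A : {set 'I_n}) (a c : config n) : config n :=
  [ffun i => if i \in A then a i else c i].

Definition normalized (psi : config n -> C) : Prop :=
  \sum_(x : config n) psi x * conjc (psi x) = 1.

(* matrix entries <a|rho_A|b> of the reduced state rho_A = tr_{[n]\A} |psi><psi| *)
Definition reduced_state (psi : config n -> C) (A : {set 'I_n}) (a b : config n) : C :=
  \sum_(c in supported (~: A)) psi (glue A a c) * conjc (psi (glue A b c)).

Definition purity (psi : config n -> C) (A : {set 'I_n}) : C :=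
  if A == finset.set0 then 1 else
  \sum_(a in supported A) \sum_(b in supported A)
     reduced_state psi A a b * reduced_state psi A b a.

(* concentratable entanglement C_{|psi>}(S) (tr(rho^2) is real) *)
Definition conc_ent (psi : config n -> C) (S : {set 'I_n}) : R :=
  1 - (2 ^+ #|S|)^-1 * \sum_(A in powerset S) complex.Re (purity psi A).

Definition bidx (b : bool) : 'I_2 := if b then ord_max else ord0.

(* (tensor_{i in S} U i  (x)  Id_{[n]\S}) |psi>, in the computational basis *)
Definition apply_local (S : {set 'I_n}) (U : 'I_n -> 'M[C]_2) (psi : config n -> C)
    (x : config n) : C :=
  \sum_(a in supported S)
     (\prod_(i in S) U i (bidx (x i)) (bidx (a i))) * psi (glue S a x).

(* P_U(z) = tr(U rho U^dag (|z><z| (x) I_{[n]\S})), z a bit string on S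
   (represented by the configuration z restricted to S) *)
Definition outcome_prob (S : {set 'I_n}) (U : 'I_n -> 'M[C]_2) (psi : config n -> C)
    (z : config n) : R :=
  \sum_(x : config n | [forall i in S, x i == z i])
     complex.Re (apply_local S U psi x * conjc (apply_local S U psi x)).

End Quantum.

Section Haar.
Variable R : realType.
Local Notation C := R[i].

Definition unitary2 (V : 'M[C]_2) : bool :=
  V *m (map_mx (@conjc R) V)^T == 1%:M.

(* real coordinates of a 2x2 complex matrix: C^{2x2} = R^8 (Borel sigma-algebra) *)
Definition mcoord (M : 'M[C]_2) : 8.-tuple R :=
  [tuple complex.Re (M ord0 ord0); complex.Im (M ord0 ord0);
         complex.Re (M ord0 ord_max); complex.Im (M ord0 ord_max);
         complex.Re (M ord_max ord0); complex.Im (M ord_max ord0);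
         complex.Re (M ord_max ord_max); complex.Im (M ord_max ord_max)].

Context {d : measure_display} {G : measurableType d}.

(* g : G -> U(2) is a random unitary under mu whose law is the Haar measure,
   i.e. the law of g is a (Borel) probability measure on U(2) that is
   left-invariant (which characterizes the Haar measure on U(2)). *)
Definition haar_random (mu : probability G R) (g : G -> 'M[C]_2) : Prop :=
  [/\ forall x, unitary2 (g x),
      measurable_fun setT (mcoord \o g) &
      forall V : 'M[C]_2, unitary2 V ->
      forall A : set (8.-tuple R), measurable A ->
        mu ((mcoord \o g) @^-1` A)%classic = mu ((fun x => mcoord (V *m g x)) @^-1` A)%classic].

(* Expectation of F over independent copies (u i)_{i in r}, each with law mu:
   iterated integral = integral against the product measure mu^{(x) r}
   (Fubini-Tonelli, F nonnegative); coordinates outside r are fixed by u. *)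
Fixpoint iter_int (mu : probability G R) (I : eqType) (r : seq I)
    (F : (I -> G) -> \bar R) (u : I -> G) : \bar R :=
  match r with
  | [::] => F u
  | i :: r' => (\int[mu]_y iter_int mu r' F (fun j => if j == i then y else u j))%E
  end.

End Haar.

Section Estimator.
Variable R : realType.

Definition median (s : seq R) : R :=
  let t := sort <=%R s in
  let k := size t in
  if odd k then t`_(k./2) else (t`_((k./2).-1) + t`_(k./2)) / 2.

Definition NB (delta : R) : nat := `| Num.ceil (8 * ln (delta^-1)) |%N.
Definition Bsz (s : nat) (eps : R) : nat := `| Num.ceil (4 * (3 / 2) ^+ s / eps ^+ 2) |%N.

(* block estimate  C^(b+1) = 1 - (3/2)^s (1/B) sum_{l = bB}^{(b+1)B - 1} 1[Z_{l,1} = Z_{l,2}]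
   (0-indexed blocks b = 0..N_B-1 and samples l = 0..L-1) *)
Definition block_est (s B L : nat) (X : 'I_L -> bool) (b : nat) : R :=
  1 - (3 / 2) ^+ s / B%:R * \sum_(l : 'I_L | (b * B <= l < b.+1 * B)%N) (X l)%:R.

End Estimator.

Section Protocol.
Variable R : realType.
Context {d : measure_display} {G : measurableType d}.
Variables (mu : probability G R) (g : G -> 'M[R[i]]_2).
Variables (n : nat) (psi : config n -> R[i]) (S : {set 'I_n}) (eps delta : R).

Definition Lsz : nat := (NB delta * Bsz #|S| eps)%N.

Definition mom_estimate (z1 z2 : {ffun 'I_Lsz -> config n}) : R :=
  median [seq block_est R #|S| (Bsz #|S| eps) (fun l => z1 l == z2 l) b
         | b <- iota 0 (NB delta)].

(* U_l = tensor_{i in S} U_{l,i}, with U_{l,i} = g (u (l, i)) *)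
Definition sample_unitary (u : 'I_Lsz * 'I_n -> G) (l : 'I_Lsz) : 'I_n -> 'M[R[i]]_2 :=
  fun i => g (u (l, i)).

Definition cond_failure (u : 'I_Lsz * 'I_n -> G) : R :=
  \sum_(z1 : {ffun 'I_Lsz -> config n} | [forall l, z1 l \in supported S])
  \sum_(z2 : {ffun 'I_Lsz -> config n} | [forall l, z2 l \in supported S])
    (\prod_(l : 'I_Lsz)
        (outcome_prob S (sample_unitary u l) psi (z1 l) *
         outcome_prob S (sample_unitary u l) psi (z2 l))) *
    (eps <= `| mom_estimate z1 z2 - conc_ent psi S |)%R%:R.

Definition failure_prob : \bar R :=
  iter_int mu [seq (l, i) | l <- enum 'I_Lsz, i <- enum S]
    (fun u => (cond_failure u)%:E) (fun _ => point).

End Protocol.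

(* Main.v *)
(* Per qubit, averaging |z><z| (x) |z><z| over a Haar-random basis and summing over
   z gives (Id + SWAP) / 3, so two outcomes of the same random local measurement
   agree with probability p = 3^-s * sum over A in S of tr(rho_A ^ 2), and
   1 - (3/2)^s p = C(S).  The fourth-order Haar moments behind this come from left
   invariance under three explicit unitaries only, together with unitarity of the
   sampled matrix.  Since (3/2)^s p <= 1, a block mean has variance at most
   (3/2)^s / B <= eps^2 / 4, so each block misses C(S) by eps with probability at
   most 1/4 (Chebyshev).  The median misses only if at least half of the blocks do;
   an exponential tilt by sqrt 3 bounds this by (sqrt 3 / 2)^N <= exp (- N / 8) <= delta.
   The conditional failure probability is a finite sum of products of functions of
   one random unitary each, so its iterated integral is computed factor by factor. *)
From HB Require Import structures.
Require Import Defs.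
From mathcomp Require Import all_boot all_order all_algebra complex.
From mathcomp Require Import all_classical all_reals all_analysis.
From mathcomp Require Import measurable_realfun.
From mathcomp Require Import ring lra zify.
Import Order.TTheory GRing.Theory Num.Theory.
Local Open Scope ring_scope.

Set Implicit Arguments.
Unset Strict Implicit.
Unset Printing Implicit Defensive.

(** * Median of means for Bernoulli samples *)

Section Median.
Variable R : realType.
Implicit Types (s : seq R) (c e : R).

Lemma median_mid s : (0 < size s)%N ->
  median s = ((sort <=%R s)`_((size s).-1./2) + (sort <=%R s)`_((size s)./2)) / 2.
Proof.
move=> s0; rewrite /median size_sort; case: ifPn => k_odd.
  have -> : ((size s).-1./2 = (size s)./2)%N by lia.
  by field.
by have -> : (((size s)./2).-1 = (size s).-1./2)%N by lia.
Qed.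

Lemma sorted_nth_le s i j : sorted <=%R s ->
  (i <= j)%N -> (j < size s)%N -> s`_i <= s`_j.
Proof.
move=> sS ij js; apply: (sorted_leq_nth le_trans le_refl) => //.
by rewrite inE (leq_ltn_trans ij).
Qed.

Lemma median_dev s c e : (0 < size s)%N -> e <= `|median s - c| ->
  (size s <= 2 * count (fun x => e <= `|x - c|)%R s)%N.
Proof.
move=> s0; rewrite median_mid//.
set t := sort _ s; have st : size t = size s by rewrite size_sort.
have sT : sorted <=%R t by apply: sort_sorted; exact: le_total.
rewrite -(permP (permEl (perm_sort <=%R s)) (fun x => e <= `|x - c|)) -/t.
have le_mid : t`_((size s).-1./2) <= t`_((size s)./2).
  by apply: sorted_nth_le => //; lia.
rewrite ler_normr => /orP[] med.
  rewrite -[X in count _ X](cat_take_drop (size s)./2 t) count_cat.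
  suff : all (fun x => e <= `|x - c|) (drop (size s)./2 t).
    by rewrite all_count => /eqP->; rewrite size_drop st; lia.
  apply/(all_nthP 0) => i; rewrite size_drop st => id; rewrite nth_drop.
  rewrite ler_normr; apply/orP; left.
  have : t`_((size s)./2) <= t`_((size s)./2 + i) by apply: sorted_nth_le => //; lia.
  by move: med; lra.
rewrite -[X in count _ X](cat_take_drop ((size s).-1./2).+1 t) count_cat.
suff : all (fun x => e <= `|x - c|) (take ((size s).-1./2).+1 t).
  by rewrite all_count => /eqP->; rewrite size_take st; case: ifP; lia.
apply/(all_nthP 0) => i; rewrite size_take st => it.
have {}it : (i < ((size s).-1./2).+1)%N by case: ifP it; lia.
rewrite nth_take// ler_normr; apply/orP; right.
have : t`_i <= t`_((size s).-1./2) by apply: sorted_nth_le => //; lia.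
by move: med; lra.
Qed.

End Median.

Section Blocks.
Variables (N B : nat).

Lemma block_index_lt (b : 'I_N) (j : 'I_B) : (b * B + j < N * B)%N.
Proof. by have := ltn_ord b; have := ltn_ord j; nia. Qed.

Definition block_index (bj : 'I_N * 'I_B) : 'I_(N * B) :=
  Ordinal (block_index_lt bj.1 bj.2).

Lemma block_of_lt (l : 'I_(N * B)) : (l %/ B < N)%N.
Proof. by have := ltn_ord l; case: B l => [|B'] l; [lia|rewrite ltn_divLR]. Qed.

Lemma block_pos_lt (l : 'I_(N * B)) : (l %% B < B)%N.
Proof. by have := ltn_ord l; case: B l => [|B'] l; [lia|rewrite ltn_mod]. Qed.

Definition block_coord (l : 'I_(N * B)) : 'I_N * 'I_B :=
  (Ordinal (block_of_lt l), Ordinal (block_pos_lt l)).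

Lemma block_indexK : cancel block_index block_coord.
Proof.
move=> [b j]; have B0 : (0 < B)%N by have := ltn_ord j; lia.
congr pair; apply: val_inj => /=.
  by rewrite divnMDl// divn_small ?addn0.
by rewrite modnMDl modn_small.
Qed.

Lemma block_coordK : cancel block_coord block_index.
Proof. by move=> l; apply: val_inj; rewrite /= -divn_eq. Qed.

Lemma block_index_bij : bijective block_index.
Proof. by exists block_coord; [exact: block_indexK|exact: block_coordK]. Qed.

Lemma in_block (b b' : 'I_N) (j : 'I_B) :
  (b * B <= block_index (b', j) < b.+1 * B)%N = (b' == b).
Proof.
apply/idP/eqP => [|->] /=; have := ltn_ord j; last by nia.
by move=> jB /andP[h1 h2]; apply: val_inj => /=; nia.
Qed.

Lemma sum_block (R : comNzRingType) (F : 'I_(N * B) -> R) (b : 'I_N) :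
  \sum_(l : 'I_(N * B) | (b * B <= l < b.+1 * B)%N) F l = \sum_(j < B) F (block_index (b, j)).
Proof.
rewrite (reindex block_index) /=; last exact/onW_bij/block_index_bij.
rewrite (eq_bigl (fun bj : 'I_N * 'I_B => (bj.1 == b) && true)); last first.
  by move=> [b' j]; rewrite in_block andbT.
by rewrite -(pair_big (fun b' => b' == b) xpredT (fun b' j => F (block_index (b', j))))
  big_pred1_eq.
Qed.

Lemma prod_block (R : comNzRingType) (F : 'I_(N * B) -> R) :
  \prod_l F l = \prod_(b < N) \prod_(j < B) F (block_index (b, j)).
Proof.
rewrite (reindex block_index) /=; last exact/onW_bij/block_index_bij.
by rewrite pair_bigA; apply: eq_bigr => -[].
Qed.

Lemma sum_prod_block (R : comNzRingType) (T : finType) (H : {ffun 'I_B -> T} -> R) :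
  \sum_(x : {ffun 'I_(N * B) -> T})
     \prod_(b < N) H [ffun j => x (block_index (b, j))] =
  (\sum_(y : {ffun 'I_B -> T}) H y) ^+ N.
Proof.
rewrite -[N in RHS]card_ord -prodr_const bigA_distr_bigA /=.
pose flat (f : {ffun 'I_N -> {ffun 'I_B -> T}}) : {ffun 'I_(N * B) -> T} :=
  [ffun l => f (block_coord l).1 (block_coord l).2].
pose unflat (x : {ffun 'I_(N * B) -> T}) : {ffun 'I_N -> {ffun 'I_B -> T}} :=
  [ffun b => [ffun j => x (block_index (b, j))]].
rewrite (reindex flat) /=; last first.
  exists unflat => [f _|x _]; last first.
    apply/ffunP => l; rewrite !ffunE.
    by rewrite -surjective_pairing block_coordK.
  by apply/ffunP => b; apply/ffunP => j; rewrite !ffunE block_indexK.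
apply: eq_bigr => f _; apply: eq_bigr => b _; congr H.
by apply/ffunP => j; rewrite !ffunE block_indexK.
Qed.

End Blocks.

Section Bernoulli.
Variable R : realType.

Definition bern (p : R) (b : bool) : R := if b then p else 1 - p.

Lemma bern_ge0 p b : 0 <= p <= 1 -> 0 <= bern p b.
Proof. by case: b => /=; lra. Qed.

Lemma sum_prod_bern p (I : finType) (F : I -> bool -> R) :
  \sum_(y : {ffun I -> bool}) \prod_i (bern p (y i) * F i (y i)) =
  \prod_i (p * F i true + (1 - p) * F i false).
Proof.
rewrite -(bigA_distr_bigA (fun i b => bern p b * F i b)).
by apply: eq_bigr => i _; rewrite big_bool.
Qed.

Lemma sum_bern1 p (I : finType) :
  \sum_(y : {ffun I -> bool}) \prod_i bern p (y i) = 1.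
Proof.
under eq_bigr do under eq_bigr do rewrite -[bern _ _]mulr1.
by rewrite (sum_prod_bern p (fun (_ : I) _ => 1)) big1// => i _; ring.
Qed.

Lemma bern_variance p B :
  \sum_(y : {ffun 'I_B -> bool}) (\prod_j bern p (y j)) *
     (\sum_j (y j)%:R - B%:R * p) ^+ 2 = B%:R * (p * (1 - p)).
Proof.
pose c (b : bool) : R := b%:R - p.
have cov j k : \sum_(y : {ffun 'I_B -> bool}) (\prod_i bern p (y i)) *
    (c (y j) * c (y k)) = (j == k)%:R * (p * (1 - p)).
  pose F i b := (if i == j then c b else 1) * (if i == k then c b else 1).
  transitivity (\sum_(y : {ffun 'I_B -> bool}) \prod_i (bern p (y i) * F i (y i))).
    apply: eq_bigr => y _; rewrite big_split /=; congr (_ * _).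
    rewrite big_split /= -!big_mkcond /= !big_pred1_eq//.
  rewrite sum_prod_bern; case: eqVneq => [jk|jk].
    rewrite (bigD1 j)//= big1 => [|i ij]; rewrite /F -jk.
      by rewrite eqxx /c /=; ring.
    by rewrite (negbTE ij); ring.
  by rewrite (bigD1 j)//= /F eqxx (negbTE jk) /c /=; ring.
transitivity (\sum_(y : {ffun 'I_B -> bool}) \sum_j \sum_k (\prod_i bern p (y i)) *
    (c (y j) * c (y k))).
  apply: eq_bigr => y _.
  have -> : \sum_j (y j)%:R - B%:R * p = \sum_j c (y j).
    by rewrite big_split /= sumr_const card_ord mulr_natl mulNrn.
  rewrite expr2 mulr_suml mulr_sumr; apply: eq_bigr => j _.
  by rewrite !mulr_sumr.
rewrite exchange_big /=.
under eq_bigr do rewrite exchange_big /=.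
under eq_bigr do under eq_bigr do rewrite cov.
under eq_bigr => j _.
  rewrite (bigD1 j)//= eqxx mul1r big1 ?addr0; last first.
    by move=> k kj; rewrite eq_sym (negbTE kj) mul0r.
  over.
by rewrite sumr_const card_ord mulr_natl.
Qed.

Lemma bern_chebyshev p B t : 0 <= p <= 1 -> 0 < t ->
  \sum_(y : {ffun 'I_B -> bool}) (\prod_j bern p (y j)) *
     (t <= `|\sum_j (y j)%:R - B%:R * p|)%R%:R <= B%:R * (p * (1 - p)) / t ^+ 2.
Proof.
move=> p01 t0; rewrite -bern_variance mulr_suml; apply: ler_sum => y _.
rewrite -mulrA ler_wpM2l//; first by apply: prodr_ge0 => j _; exact: bern_ge0.
set v := _ - _; case: (leP t) => [tv|_] /=; last by apply: divr_ge0; rewrite sqr_ge0.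
rewrite ler_pdivlMr ?exprn_gt0// mul1r -[v ^+ 2]real_normK ?num_real//.
by rewrite lerXn2r// nnegrE ?ltW// (lt_le_trans t0).
Qed.

Lemma chernoff_factor (delta : R) (N : nat) : 0 < delta ->
  8 * ln delta^-1 <= N%:R -> (Num.sqrt 3 / 2) ^+ N <= delta.
Proof.
move=> d0 hN.
have h8 : Num.sqrt 3 / 2 <= expR (- 8^-1) :> R.
  rewrite -(@ler_pXn2r R 2)// ?nnegrE ?expR_ge0 ?divr_ge0 ?sqrtr_ge0//.
  rewrite exprMn sqr_sqrtr// -expRM_natl.
  by apply: le_trans (expR_ge1Dx _); lra.
apply: (@le_trans _ _ (expR (- 8^-1) ^+ N)).
  by rewrite lerXn2r// ?nnegrE ?expR_ge0// divr_ge0 ?sqrtr_ge0.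
have dpos : delta \is Num.pos by rewrite posrE.
rewrite -expRM_natl -[leRHS](lnK dpos).
by rewrite ler_expR; move: hN; rewrite lnV ?posrE//; lra.
Qed.

Lemma NB_ge (delta : R) : 0 < delta < 1 -> 8 * ln delta^-1 <= (NB delta)%:R.
Proof.
move=> /andP[d0 d1]; apply: le_trans (ceil_ge _) _.
by rewrite /NB natr_absz ler_int ler_norm.
Qed.

Lemma NB_gt0 (delta : R) : 0 < delta < 1 -> (0 < NB delta)%N.
Proof.
move=> d01; have := NB_ge d01; case: (NB delta) => // h.
have /andP[d0 d1] := d01; have : 0 < ln delta^-1 by rewrite ln_gt0// invf_gt1.
by move: h; lra.
Qed.

Lemma Bsz_ge s (eps : R) : 4 * (3 / 2) ^+ s / eps ^+ 2 <= (Bsz s eps)%:R.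
Proof.
apply: le_trans (ceil_ge _) _.
by rewrite /Bsz natr_absz ler_int ler_norm.
Qed.

Lemma median_of_means_bound (s : nat) (eps delta p : R) :
  0 < eps -> 0 < delta < 1 -> 0 <= p -> (3 / 2) ^+ s * p <= 1 ->
  \sum_(x : {ffun 'I_(NB delta * Bsz s eps) -> bool}) (\prod_l bern p (x l)) *
    (eps <= `|median [seq block_est R s (Bsz s eps) x b | b <- iota 0 (NB delta)]
              - (1 - (3 / 2) ^+ s * p)|)%R%:R <= delta.
Proof.
move=> e0 d01 p0 ap1.
have d0 : 0 < delta by case/andP: d01.
set N := NB delta; set B := Bsz s eps; set a := (3 / 2) ^+ s in ap1 *.
have a1 : 1 <= a by rewrite exprn_ege1//; lra.
have p01 : 0 <= p <= 1 by nra.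
have Bge : 4 * a / eps ^+ 2 <= B%:R := Bsz_ge s eps.
have e20 : 0 < eps ^+ 2 by rewrite exprn_gt0.
have B0 : 0 < B%:R :> R by apply: lt_le_trans Bge; rewrite divr_gt0//; lra.
have r3 : 0 < Num.sqrt 3 :> R by rewrite sqrtr_gt0.
have r32 : Num.sqrt 3 ^+ 2 = 3 :> R by rewrite sqr_sqrtr.
pose t := eps * B%:R / a.
have t0 : 0 < t by rewrite divr_gt0 ?mulr_gt0//; lra.
pose bad (y : {ffun 'I_B -> bool}) := t <= `|\sum_j (y j)%:R - B%:R * p|.
(* tilt b = sqrt 3 ^ (2 b - 1), with mean at most (1 + 2 / 4) / sqrt 3 = sqrt 3 / 2 *)
pose tilt (b : bool) : R := Num.sqrt 3 ^+ (2 * b) / Num.sqrt 3.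
pose H (y : {ffun 'I_B -> bool}) := (\prod_j bern p (y j)) * tilt (bad y).
have badE (x : {ffun 'I_(N * B) -> bool}) (b : 'I_N) :
    (eps <= `|block_est R s B x b - (1 - a * p)|) =
    bad [ffun j => x (block_index (b, j))].
  rewrite /block_est sum_block /bad.
  under [in RHS]eq_bigr do rewrite ffunE.
  set v := \sum_j _; rewrite -/a /t ler_pdivrMr; last by lra.
  have -> : 1 - a / B%:R * v - (1 - a * p) = - (a / B%:R * (v - B%:R * p)).
    by field; rewrite gt_eqF.
  rewrite normrN normrM (gtr0_norm (x := a / _)) ?divr_gt0//; last by lra.
  by rewrite mulrAC ler_pdivlMr// (mulrC a).
apply: (@le_trans _ _ (\sum_(x : {ffun 'I_(N * B) -> bool})
     \prod_(b < N) H [ffun j => x (block_index (b, j))])).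
  apply: ler_sum => x _; rewrite prod_block big_split /=.
  have -> : \prod_(b < N) \prod_(j < B) bern p ([ffun j => x (block_index (b, j))] j) =
      \prod_(b < N) \prod_(j < B) bern p (x (block_index (b, j))).
    by apply: eq_bigr => b _; apply: eq_bigr => j _; rewrite ffunE.
  apply: ler_wpM2l.
    by apply: prodr_ge0 => b _; apply: prodr_ge0 => j _; exact: bern_ge0.
  case: (leP eps) => [med|_] /=; last first.
    by apply: prodr_ge0 => b _; rewrite divr_ge0 ?exprn_ge0 ?sqrtr_ge0.
  have {}med := @median_dev _ _ _ _ _ med.
  rewrite size_map size_iota in med; have {}med := med (NB_gt0 d01).
  rewrite count_map -sum1_count big_mkcond /= -[N in iota _ N]subn0 in med.
  rewrite big_mkord in med.
  rewrite big_split /= prodr_const card_ord.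
  rewrite -expr_sum -big_distrr /= exprVn ler_pdivlMr ?exprn_gt0// mul1r.
  rewrite ler_eXn2l//; last first.
    by rewrite -[ltLHS]sqrtr1 ltr_sqrt; lra.
  apply: leq_trans med _; rewrite leq_mul2l /=; apply: leq_sum => b _.
  by rewrite -badE; case: ifP.
rewrite sum_prod_block; apply: le_trans (chernoff_factor d0 (NB_ge d01)).
apply: lerXn2r; rewrite ?nnegrE ?divr_ge0 ?sqrtr_ge0//.
  apply: sumr_ge0 => y _; rewrite mulr_ge0 ?divr_ge0 ?exprn_ge0 ?sqrtr_ge0//.
  by apply: prodr_ge0 => j _; exact: bern_ge0.
have tiltE b : tilt b = (1 + 2 * b%:R) / Num.sqrt 3.
  by rewrite /tilt; case: b; rewrite ?muln1 ?muln0 /= ?r32 ?expr0; congr (_ / _); lra.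
under eq_bigr do rewrite /H tiltE mulrA mulrDr mulr1 mulrCA.
rewrite -mulr_suml big_split /= sum_bern1 -mulr_sumr.
rewrite ler_pdivrMr// mulrAC -expr2 r32.
have cheb := bern_chebyshev B p01 t0.
suff : B%:R * (p * (1 - p)) / t ^+ 2 <= 4^-1.
  by move=> /(le_trans cheb); rewrite /bad; lra.
rewrite ler_pdivrMr ?exprn_gt0// /t expr_div_n.
have a20 : 0 < a ^+ 2 by rewrite exprn_gt0//; lra.
rewrite [leRHS]mulrA ler_pdivlMr//.
rewrite ler_pdivrMr// in Bge.
have apa : a * p * (1 - p) <= 1 by nra.
rewrite exprMn.
have : a * (a * p * (1 - p)) <= a by nra.
have -> : B%:R * (p * (1 - p)) * a ^+ 2 = B%:R * (a * (a * p * (1 - p))) by ring.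
have -> : 4^-1 * (eps ^+ 2 * B%:R ^+ 2) = B%:R * (4^-1 * (B%:R * eps ^+ 2)) by ring.
move=> h; rewrite ler_pM2l//; lra.
Qed.

End Bernoulli.

(** * Iterated integrals of sums of products *)

Section ComplexParts.
Variable R : realType.
Implicit Types x y : R[i].

Lemma Re_addc x y : complex.Re (x + y) = complex.Re x + complex.Re y.
Proof. by case: x y => [a b] [c d]. Qed.

Lemma Im_addc x y : complex.Im (x + y) = complex.Im x + complex.Im y.
Proof. by case: x y => [a b] [c d]. Qed.

Lemma Re_mulc x y :
  complex.Re (x * y) = complex.Re x * complex.Re y - complex.Im x * complex.Im y.
Proof. by case: x y => [a b] [c d]. Qed.

Lemma Im_mulc x y :
  complex.Im (x * y) = complex.Re x * complex.Im y + complex.Im x * complex.Re y.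
Proof. by case: x y => [a b] [c d]. Qed.

Lemma Re_conjc x : complex.Re (conjc x) = complex.Re x.
Proof. by case: x. Qed.

Lemma Im_conjc x : complex.Im (conjc x) = - complex.Im x.
Proof. by case: x. Qed.

Lemma conjcM x y : conjc (x * y) = conjc x * conjc y.
Proof. exact: rmorphM. Qed.

Lemma conjc_prod (I : Type) (r : seq I) (P : pred I) (F : I -> R[i]) :
  conjc (\prod_(i <- r | P i) F i) = \prod_(i <- r | P i) conjc (F i).
Proof. exact: rmorph_prod. Qed.

Lemma conjc_sum (I : Type) (r : seq I) (P : pred I) (F : I -> R[i]) :
  conjc (\sum_(i <- r | P i) F i) = \sum_(i <- r | P i) conjc (F i).
Proof. exact: rmorph_sum. Qed.

End ComplexParts.

Section BoundedMeasurable.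
Context {R : realType} {d : measure_display} {G : measurableType d}.
Variable mu : probability G R.

Definition bmeas (f : G -> R) : Prop :=
  measurable_fun setT f /\ exists M : R, forall x, `|f x| <= M.

Lemma bmeas_cst c : bmeas (fun => c).
Proof. by split; [exact: measurable_cst|exists `|c|]. Qed.

Lemma bmeasD f g : bmeas f -> bmeas g -> bmeas (fun x => f x + g x).
Proof.
move=> [mf [M fM]] [mg [N gN]]; split; first exact: measurable_funD.
by exists (M + N) => x; apply: le_trans (ler_normD _ _) (lerD _ _).
Qed.

Lemma bmeasM f g : bmeas f -> bmeas g -> bmeas (fun x => f x * g x).
Proof.
move=> [mf [M fM]] [mg [N gN]]; split; first exact: measurable_funM.
by exists (M * N) => x; rewrite normrM ler_pM.
Qed.

Lemma bmeasN f : bmeas f -> bmeas (fun x => - f x).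
Proof.
move=> [mf [M fM]]; split; first exact: measurableT_comp.
by exists M => x; rewrite normrN.
Qed.

Lemma bmeas_integrable f : bmeas f -> mu.-integrable setT (EFin \o f).
Proof.
move=> [mf [M fM]]; apply: measurable_bounded_integrable => //.
  by apply: (le_lt_trans (probability_le1 mu measurableT)); rewrite ltry.
exists M; split; first exact: num_real.
by move=> r Mr x _; apply: le_trans (fM x) (ltW Mr).
Qed.

Lemma Rintegral_prob_cst c : \int[mu]_(x in setT) c = c.
Proof.
rewrite Rintegral_cst// -[RHS]mulr1; congr (_ * _).
exact: (congr1 fine (probability_setT mu)).
Qed.

Definition cbmeas (f : G -> R[i]) : Prop :=
  bmeas (fun x => complex.Re (f x)) /\ bmeas (fun x => complex.Im (f x)).

Lemma cbmeas_cst c : cbmeas (fun => c).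
Proof. by split; exact: bmeas_cst. Qed.

Lemma cbmeasD f g : cbmeas f -> cbmeas g -> cbmeas (fun x => f x + g x).
Proof.
move=> [rf jf] [rg jg]; split; under eq_fun do rewrite ?Re_addc ?Im_addc; exact: bmeasD.
Qed.

Lemma cbmeasM f g : cbmeas f -> cbmeas g -> cbmeas (fun x => f x * g x).
Proof.
move=> [rf jf] [rg jg]; split; under eq_fun do rewrite ?Re_mulc ?Im_mulc.
  by apply: bmeasD; [|apply: bmeasN]; exact: bmeasM.
by apply: bmeasD; exact: bmeasM.
Qed.

Lemma cbmeas_conj f : cbmeas f -> cbmeas (fun x => conjc (f x)).
Proof.
move=> [rf jf]; split; first by under eq_fun do rewrite Re_conjc.
by under eq_fun do rewrite Im_conjc; exact: bmeasN.
Qed.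

Lemma cbmeas_sum (I : Type) (r : seq I) (f : I -> G -> R[i]) :
  (forall i, cbmeas (f i)) -> cbmeas (fun x => \sum_(i <- r) f i x).
Proof.
move=> mf; elim: r => [|i r IH].
  by under eq_fun do rewrite big_nil; exact: cbmeas_cst.
by under eq_fun do rewrite big_cons; exact: cbmeasD.
Qed.

Definition cmean (f : G -> R[i]) : R[i] :=
  Complex (\int[mu]_(x in setT) complex.Re (f x)) (\int[mu]_(x in setT) complex.Im (f x)).

Lemma eq_cmean f g : f =1 g -> cmean f = cmean g.
Proof. by move=> /funext->. Qed.

Lemma cmean_cst c : cmean (fun => c) = c.
Proof. by rewrite /cmean !Rintegral_prob_cst; case: c. Qed.

Lemma cmeanD f g : cbmeas f -> cbmeas g ->
  cmean (fun x => f x + g x) = cmean f + cmean g.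
Proof.
move=> [rf jf] [rg jg]; rewrite /cmean.
under eq_Rintegral do rewrite Re_addc.
under [X in Complex _ X]eq_Rintegral do rewrite Im_addc.
by rewrite !RintegralD//; exact: bmeas_integrable.
Qed.

Lemma cmeanZ c f : cbmeas f -> cmean (fun x => c * f x) = c * cmean f.
Proof.
case: c => a b [rf jf]; rewrite /cmean.
under eq_Rintegral do rewrite Re_mulc /=.
under [X in Complex _ X]eq_Rintegral do rewrite Im_mulc /=.
have aI (k : R) h : bmeas h -> bmeas (fun x => k * h x).
  by move=> mh; apply: bmeasM => //; exact: bmeas_cst.
rewrite RintegralB//; [|exact/bmeas_integrable/aI..].
rewrite RintegralD//; [|exact/bmeas_integrable/aI..].
by rewrite !RintegralZl//; exact: bmeas_integrable.
Qed.

Lemma cmean_sum (I : Type) (r : seq I) (f : I -> G -> R[i]) :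
  (forall i, cbmeas (f i)) ->
  cmean (fun x => \sum_(i <- r) f i x) = \sum_(i <- r) cmean (f i).
Proof.
move=> mf; elim: r => [|i r IH].
  by under eq_cmean do rewrite big_nil; rewrite cmean_cst big_nil.
under eq_cmean do rewrite big_cons.
by rewrite cmeanD// ?IH ?big_cons//; exact: cbmeas_sum.
Qed.

Section IteratedIntegral.
Variable I : eqType.
Implicit Types (r : seq I) (u v : I -> G).

Lemma eq_iter_int r (F F' : (I -> G) -> \bar R) u :
  (forall v, {in [predC r], v =1 u} -> F v = F' v) ->
  iter_int mu r F u = iter_int mu r F' u.
Proof.
elim: r u => [|i r IH] u FF' /=; first exact: FF'.
apply: eq_integral => y _; apply: IH => v vu; apply: FF' => j.
rewrite !inE negb_or => /andP[ji jr]; rewrite vu ?inE//.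
by rewrite (negbTE ji).
Qed.

Lemma iter_int_sum_prod (K : finType) (f : K -> I -> G -> R[i]) r :
  (forall k i, cbmeas (f k i)) -> uniq r -> forall (c : K -> R[i]) u,
  iter_int mu r (fun v => (complex.Re (\sum_k c k * \prod_(i <- r) f k i (v i)))%:E) u =
  (complex.Re (\sum_k c k * \prod_(i <- r) cmean (f k i)))%:E.
Proof.
move=> mf; elim: r => [|i r IH] /= => [_ c u|/andP[ir ur] c u].
  by congr (complex.Re _)%:E; apply: eq_bigr => k _; rewrite !big_nil.
transitivity (\int[mu]_y (complex.Re (\sum_k (c k * \prod_(j <- r) cmean (f k j)) *
    f k i y))%:E)%E.
  apply: eq_integral => y _.
  rewrite (@eq_iter_int _ _ (fun v =>
      (complex.Re (\sum_k (c k * f k i y) * \prod_(j <- r) f k j (v j)))%:E)).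
    rewrite IH//; congr (complex.Re _)%:E.
    by apply: eq_bigr => k _; rewrite mulrAC.
  move=> v vE; congr (complex.Re _)%:E; apply: eq_bigr => k _.
  by rewrite big_cons mulrA vE ?inE ?ir// eqxx.
have mkf k : cbmeas (fun y => c k * (\prod_(j <- r) cmean (f k j)) * f k i y).
  by apply: cbmeasM => //; exact: cbmeas_cst.
rewrite -[LHS]fineK; last first.
  apply: integrable_fin_num => //; apply: bmeas_integrable.
  exact: (cbmeas_sum (index_enum K) mkf).1.
congr EFin.
rewrite -[LHS]/(complex.Re (cmean (fun y =>
  \sum_k (c k * \prod_(j <- r) cmean (f k j)) * f k i y))).
rewrite cmean_sum//; congr complex.Re; apply: eq_bigr => k _.
by rewrite cmeanZ// big_cons mulrAC mulrA.
Qed.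

End IteratedIntegral.
End BoundedMeasurable.

Section LawIntegral.
Context {R : realType} {d d' : measure_display}.
Context {G : measurableType d} {T : measurableType d'}.
Variable mu : probability G R.

Lemma eq_law_Rintegral (phi phi' : G -> T) (f : T -> R) :
  measurable_fun setT phi -> measurable_fun setT phi' ->
  (forall A, measurable A -> mu (phi @^-1` A)%classic = mu (phi' @^-1` A)%classic) ->
  measurable_fun setT f ->
  bmeas (fun x => f (phi x)) -> bmeas (fun x => f (phi' x)) ->
  \int[mu]_(x in setT) f (phi x) = \int[mu]_(x in setT) f (phi' x).
Proof.
move=> mphi mphi' law mf bf bf'.
pose X : {mfun G >-> T} := HB.pack phi (isMeasurableFun.Build _ _ _ _ _ mphi).
pose X' : {mfun G >-> T} := HB.pack phi' (isMeasurableFun.Build _ _ _ _ _ mphi').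
have mF : measurable_fun setT (EFin \o f) by exact/measurable_EFinP.
congr fine.
rewrite -[LHS](@integral_pushforward _ _ _ _ R _ mphi mu setT _ mF)//; last first.
  by rewrite preimage_setT; exact: bmeas_integrable.
rewrite -[RHS](@integral_pushforward _ _ _ _ R _ mphi' mu setT _ mF)//; last first.
  by rewrite preimage_setT; exact: bmeas_integrable.
apply: (@eq_measure_integral _ _ _ _ (pushforward mu X') (pushforward mu X)).
by move=> A mA _; exact: law.
Qed.

End LawIntegral.

(** * Haar moments on U(2) *)

Section HaarMoments.
Context {R : realType} {d : measure_display} {G : measurableType d}.
Variables (mu : probability G R) (g : G -> 'M[R[i]]_2).
Hypothesis haar_g : haar_random mu g.

Definition mx_of_coord (t : 8.-tuple R) : 'M[R[i]]_2 :=
  \matrix_(x, a) if x == ord0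
    then if a == ord0 then Complex (tnth t (inord 0)) (tnth t (inord 1))
         else Complex (tnth t (inord 2)) (tnth t (inord 3))
    else if a == ord0 then Complex (tnth t (inord 4)) (tnth t (inord 5))
         else Complex (tnth t (inord 6)) (tnth t (inord 7)).

Lemma mcoordK : cancel (@mcoord R) mx_of_coord.
Proof.
move=> M; apply/matrixP => x a; rewrite mxE !(tnth_nth 0) !inordK//=.
have ord2 (y : 'I_2) : y = if y == ord0 then ord0 else ord_max.
  by apply: val_inj; case: y => -[|[]].
rewrite (ord2 x) (ord2 a).
by case: (x == ord0); case: (a == ord0) => /=; case: (M _ _).
Qed.

Lemma unitary2_unitE (V : 'M[R[i]]_2) a b : unitary2 V ->
  \sum_x V x a * conjc (V x b) = (a == b)%:R.
Proof.
move=> /eqP /mulmx1C /matrixP/(_ b a); rewrite !mxE eq_sym => <-.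
by apply: eq_bigr => x _; rewrite !mxE mulrC.
Qed.

Lemma unitary2_entry_le1 (V : 'M[R[i]]_2) x a : unitary2 V ->
  `|complex.Re (V x a)| <= 1 /\ `|complex.Im (V x a)| <= 1.
Proof.
move=> /(unitary2_unitE a a); rewrite eqxx.
have term y : V y a * conjc (V y a) =
    Complex (complex.Re (V y a) ^+ 2 + complex.Im (V y a) ^+ 2) 0.
  by case: (V y a) => p q /=; congr Complex; ring.
rewrite (bigD1 x)//= term => /(congr1 (@complex.Re R)); rewrite Re_addc /=.
set s := complex.Re (bigop.body _ _ _); have s0 : 0 <= s.
  apply: (big_rec (fun z => 0 <= complex.Re z)) => // y z _ z0; rewrite Re_addc term /=.
  by rewrite addr_ge0// addr_ge0 ?sqr_ge0.
by move=> h; rewrite !ler_norml; split; apply/andP; split; nra.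
Qed.

Lemma measurable_mx_of_coord x a :
  measurable_fun setT (fun t => complex.Re (mx_of_coord t x a)) /\
  measurable_fun setT (fun t => complex.Im (mx_of_coord t x a)).
Proof.
split.
  by under eq_fun do rewrite mxE; case: (x == ord0); case: (a == ord0) => /=;
    exact: measurable_tnth.
by under eq_fun do rewrite mxE; case: (x == ord0); case: (a == ord0) => /=;
  exact: measurable_tnth.
Qed.

Lemma cbmeas_entry x a : cbmeas (fun w => g w x a).
Proof.
have [ug mg _] := haar_g.
have [mRe mIm] := measurable_mx_of_coord x a.
split; split.
- under eq_fun do rewrite -[g _]mcoordK.
  exact: (measurableT_comp mRe mg).
- by exists 1 => w; have [] := unitary2_entry_le1 x a (ug w).
- under eq_fun do rewrite -[g _]mcoordK.
  exact: (measurableT_comp mIm mg).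
- by exists 1 => w; have [] := unitary2_entry_le1 x a (ug w).
Qed.

Definition quartic (V : 'M[R[i]]_2) (x a y b x' a' y' b' : 'I_2) : R[i] :=
  V x a * conjc (V y b) * (V x' a' * conjc (V y' b')).

Definition haar_moment x a y b x' a' y' b' : R[i] :=
  cmean mu (fun w => quartic (g w) x a y b x' a' y' b').

Lemma cbmeas_quartic x a y b x' a' y' b' :
  cbmeas (fun w => quartic (g w) x a y b x' a' y' b').
Proof.
have cbm := cbmeas_entry.
by apply: cbmeasM; apply: cbmeasM => //; exact: cbmeas_conj.
Qed.

Lemma cbmeas_mul_entry (V : 'M[R[i]]_2) x a : cbmeas (fun w => (V *m g w) x a).
Proof.
under eq_fun do rewrite mxE.
by apply: cbmeas_sum => k; apply: cbmeasM; [exact: cbmeas_cst|exact: cbmeas_entry].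
Qed.

Lemma measurable_mcoord_mul (V : 'M[R[i]]_2) :
  measurable_fun setT (fun w => mcoord (V *m g w)).
Proof.
apply/measurable_fun_tnthP => i.
have mV x a := cbmeas_mul_entry V x a.
by case: i => -[|[|[|[|[|[|[|[|]]]]]]]] // p;
  rewrite /comp; under eq_fun do rewrite (tnth_nth 0) /=;
  [exact: (mV _ _).1.1|exact: (mV _ _).2.1|exact: (mV _ _).1.1|exact: (mV _ _).2.1
  |exact: (mV _ _).1.1|exact: (mV _ _).2.1|exact: (mV _ _).1.1|exact: (mV _ _).2.1].
Qed.

Lemma measurable_quartic x a y b x' a' y' b' :
  measurable_fun setT (fun t => complex.Re (quartic (mx_of_coord t) x a y b x' a' y' b')) /\
  measurable_fun setT (fun t => complex.Im (quartic (mx_of_coord t) x a y b x' a' y' b')).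
Proof.
have M (f h : 8.-tuple R -> R[i]) :
    measurable_fun setT (fun t => complex.Re (f t)) /\
      measurable_fun setT (fun t => complex.Im (f t)) ->
    measurable_fun setT (fun t => complex.Re (h t)) /\
      measurable_fun setT (fun t => complex.Im (h t)) ->
    measurable_fun setT (fun t => complex.Re (f t * h t)) /\
      measurable_fun setT (fun t => complex.Im (f t * h t)).
  move=> [rf jf] [rh jh]; split.
    by under eq_fun do rewrite Re_mulc; apply: measurable_funB; exact: measurable_funM.
  by under eq_fun do rewrite Im_mulc; apply: measurable_funD; exact: measurable_funM.
have J k l : measurable_fun setT (fun t => complex.Re (conjc (mx_of_coord t k l))) /\
      measurable_fun setT (fun t => complex.Im (conjc (mx_of_coord t k l))).
  have [mr mi] := measurable_mx_of_coord k l; split.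
    by under eq_fun do rewrite Re_conjc.
  by under eq_fun do rewrite Im_conjc; exact: measurableT_comp.
by apply: (@M _ _); apply: (@M _ _) => //; exact: measurable_mx_of_coord.
Qed.

Lemma haar_moment_mull (V : 'M[R[i]]_2) x a y b x' a' y' b' : unitary2 V ->
  haar_moment x a y b x' a' y' b' =
  \sum_k \sum_l \sum_k' \sum_l' V x k * conjc (V y l) * (V x' k' * conjc (V y' l')) *
    haar_moment k a l b k' a' l' b'.
Proof.
move=> uV; have [ug mg inv] := haar_g.
have bq := cbmeas_quartic x a y b x' a' y' b'.
have bqV : cbmeas (fun w => quartic (V *m g w) x a y b x' a' y' b').
  have mV := cbmeas_mul_entry V.
  by apply: cbmeasM; apply: cbmeasM => //; exact: cbmeas_conj.
have [mRe mIm] := measurable_quartic x a y b x' a' y' b'.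
have mgV := measurable_mcoord_mul V.
transitivity (cmean mu (fun w => quartic (V *m g w) x a y b x' a' y' b')).
  pose q t := quartic (mx_of_coord t) x a y b x' a' y' b'.
  have qg w : quartic (g w) x a y b x' a' y' b' = q (mcoord (g w)).
    by rewrite /q mcoordK.
  have qVg w : quartic (V *m g w) x a y b x' a' y' b' = q (mcoord (V *m g w)).
    by rewrite /q mcoordK.
  rewrite (funext qg) in bq; rewrite (funext qVg) in bqV.
  rewrite /haar_moment (eq_cmean _ qg) (eq_cmean _ qVg); congr Complex.
    exact: (eq_law_Rintegral mg mgV (inv V uV) mRe bq.1 bqV.1).
  exact: (eq_law_Rintegral mg mgV (inv V uV) mIm bq.2 bqV.2).
rewrite (@eq_cmean _ _ _ _ _ (fun w => \sum_k \sum_l \sum_k' \sum_l'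
    (V x k * conjc (V y l) * (V x' k' * conjc (V y' l'))) *
      quartic (g w) k a l b k' a' l' b')); last first.
  move=> w; rewrite /quartic !mxE !conjc_sum !mulr_suml.
  apply: eq_bigr => k _; rewrite [X in X * _]mulr_sumr mulr_suml.
  apply: eq_bigr => l _; rewrite mulr_sumr.
  apply: eq_bigr => k' _; rewrite !mulr_sumr.
  apply: eq_bigr => l' _.
  by rewrite !conjcM; ring.
have bZ c k l k' l' : cbmeas (fun w => c * quartic (g w) k a l b k' a' l' b').
  by apply: cbmeasM; [exact: cbmeas_cst|exact: cbmeas_quartic].
rewrite cmean_sum; last by move=> k; do 3 apply: cbmeas_sum => ?.
apply: eq_bigr => k _.
rewrite cmean_sum; last by move=> l; do 2 apply: cbmeas_sum => ?.
apply: eq_bigr => l _.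
rewrite cmean_sum; last by move=> k'; apply: cbmeas_sum => ?.
apply: eq_bigr => k' _; rewrite cmean_sum//; apply: eq_bigr => l' _.
by rewrite cmeanZ//; exact: cbmeas_quartic.
Qed.

Definition mx2 (p q r s : R[i]) : 'M[R[i]]_2 :=
  \matrix_(x, y) if x == ord0 then if y == ord0 then p else q
                 else if y == ord0 then r else s.

Let o : 'I_2 := ord0.
Let e : 'I_2 := ord_max.

Lemma sum2E (F : 'I_2 -> R[i]) : \sum_x F x = F o + F e.
Proof.
rewrite big_ord_recl big_ord1; congr (_ + F _).
exact: val_inj.
Qed.

Lemma ord2_cases (x : 'I_2) : x = o \/ x = e.
Proof. by case: x => -[|[|]]// i; [left|right]; apply: val_inj. Qed.

Lemma mx2E p q r s : (mx2 p q r s o o = p) * (mx2 p q r s o e = q) *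
  (mx2 p q r s e o = r) * (mx2 p q r s e e = s).
Proof. by do ?split; rewrite mxE. Qed.

Lemma unitary2_mx2 (p q r s : R[i]) :
  p * conjc p + q * conjc q = 1 -> p * conjc r + q * conjc s = 0 ->
  r * conjc r + s * conjc s = 1 -> unitary2 (mx2 p q r s).
Proof.
move=> h1 h2 h3; have h4 : r * conjc p + s * conjc q = 0.
  rewrite -[RHS]conjc0 -h2 rmorphD !rmorphM /= !conjcK; ring.
apply/eqP/matrixP => x y; rewrite !mxE sum2E !mxE /=.
by case: (ord2_cases x) => ->; case: (ord2_cases y) => ->.
Qed.

Lemma haar_moment_swap a b a' b' : haar_moment o a o b o a' o b' =
  haar_moment e a e b e a' e b'.
Proof.
have uX : unitary2 (mx2 0 1 1 0).
  by apply: unitary2_mx2; rewrite ?conjc0 ?conjc1; ring.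
rewrite (haar_moment_mull _ _ _ _ _ _ _ _ uX) !sum2E !mx2E conjc0 conjc1.
by ring.
Qed.

(* Left multiplication by diag(1, i) scales a moment by i ^ (x + x' - y - y'), and
   this exponent lies in [-2, 2]. *)
Lemma haar_moment_unbalanced (x a y b x' a' y' b' : 'I_2) : (x + x' != y + y')%N ->
  haar_moment x a y b x' a' y' b' = 0.
Proof.
have JJ : Complex 0 1 * conjc (Complex 0 1) = 1 :> R[i] by congr Complex; ring.
have uD : unitary2 (mx2 1 0 0 (Complex 0 1)).
  by apply: unitary2_mx2; rewrite ?conjc0 ?conjc1 ?JJ; ring.
have := haar_moment_mull x a y b x' a' y' b' uD.
pose T k l k' l' := haar_moment k a l b k' a' l' b'.
rewrite -/(T x y x' y'); under eq_bigr do under eq_bigr do under eq_bigr do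
  under eq_bigr do rewrite -/(T _ _ _ _).
move: T => T; set J : R[i] := Complex 0 1; set t := T x y x' y' => ht xy.
have {}ht : t = J ^+ x * conjc J ^+ y * (J ^+ x' * conjc J ^+ y') * t.
  have [v0 v1] : nat_of_ord o = 0%N /\ nat_of_ord e = 1%N by [].
  rewrite {1}ht /t !sum2E.
  case: (ord2_cases x) => ->; case: (ord2_cases y) => ->;
  case: (ord2_cases x') => ->; case: (ord2_cases y') => ->;
  by rewrite !mx2E ?conjc0 ?conjc1 ?(v0, v1) ?expr0 ?expr1; ring.
apply/eqP; have := subrr t; rewrite {2}ht -{1}[t]mul1r -mulrBl => /eqP.
rewrite mulf_eq0 => /orP[/eqP h|//]; exfalso; move: h xy {t ht}.
case: (ord2_cases x) => ->; case: (ord2_cases y) => ->;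
case: (ord2_cases x') => ->; case: (ord2_cases y') => -> //=;
by rewrite ?expr0 ?expr1 => /(congr1 (@complex.Re R)) /= h _; move: h; lra.
Qed.

Lemma haar_moment_trace a b a' b' :
  \sum_y \sum_y' haar_moment y a y b y' a' y' b' = (a == b)%:R * (a' == b')%:R.
Proof.
have [ug _ _] := haar_g; have bq := cbmeas_quartic.
transitivity (cmean mu (fun w => \sum_y \sum_y' quartic (g w) y a y b y' a' y' b')).
  rewrite cmean_sum; last by move=> y; apply: cbmeas_sum.
  by apply: eq_bigr => y _; rewrite cmean_sum.
rewrite -[RHS](cmean_cst mu); apply: eq_cmean => w.
rewrite -(unitary2_unitE a b (ug w)) -(unitary2_unitE a' b' (ug w)) mulr_suml.
by apply: eq_bigr => y _; rewrite mulr_sumr.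
Qed.

Lemma haar_moment_row x a b a' b' :
  haar_moment x a x b x a' x b' =
  ((a == b)%:R * (a' == b')%:R + (a == b')%:R * (a' == b)%:R) / 6.
Proof.
have [ug _ _] := haar_g.
have [h hh] : exists h : R[i], h * conjc h = 2^-1.
  exists (Complex 2^-1 2^-1).
  rewrite -(rmorph_nat (real_complex R)) -fmorphV.
  by congr Complex; field.
pose t y k y' k' := haar_moment y a k b y' a' k' b'.
have Z (y k y' k' : 'I_2) : (y + y' != k + k')%N -> t y k y' k' = 0.
  exact: haar_moment_unbalanced.
(* a multiple of the Hadamard gate, with entries that avoid sqrt 2 *)
have uH : unitary2 (mx2 h h h (- h)).
  by apply: unitary2_mx2; rewrite ?rmorphN /= ?mulrN ?mulNr ?opprK hh; field.
have tH : 4 * t o o o o = t o o o o + t e e e e + t o o e e + t o e e o + t e o o e + t e e o o.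
  have := haar_moment_mull o a o b o a' o b' uH.
  rewrite !sum2E !mx2E hh -!/(t _ _ _ _).
  rewrite (Z o o o e)// (Z o o e o)// (Z o e o o)// (Z e o o o)// (Z e e e o)//.
  rewrite (Z e e o e)// (Z e o e e)// (Z o e e e)// (Z o e o e)// (Z e o e o)//.
  by move=> {1}->; field.
have tX : t e e e e = t o o o o by rewrite /t haar_moment_swap.
have bq := cbmeas_quartic.
have contr1 : \sum_y \sum_y' t y y y' y' = (a == b)%:R * (a' == b')%:R.
  exact: haar_moment_trace.
have contr2 : \sum_y \sum_y' t y y' y' y = (a == b')%:R * (a' == b)%:R.
  transitivity (cmean mu (fun w => \sum_y \sum_y' quartic (g w) y a y' b y' a' y b')).
    rewrite cmean_sum; last by move=> y; apply: cbmeas_sum.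
    by apply: eq_bigr => y _; rewrite cmean_sum.
  rewrite -[RHS](cmean_cst mu); apply: eq_cmean => w.
  rewrite -(unitary2_unitE a b' (ug w)) -(unitary2_unitE a' b (ug w)) mulr_suml.
  apply: eq_bigr => y _; rewrite mulr_sumr; apply: eq_bigr => y' _.
  by rewrite /quartic; ring.
have t0 : t o o o o = ((a == b)%:R * (a' == b')%:R + (a == b')%:R * (a' == b)%:R) / 6.
  have n6 : (6 : R[i]) != 0 by rewrite pnatr_eq0.
  apply: (mulIf n6); rewrite divfK// -contr1 -contr2 !sum2E tX.
  transitivity (4 * t o o o o + 2 * t o o o o); first by ring.
  by rewrite tH tX; ring.
by rewrite -t0; case: (ord2_cases x) => ->.
Qed.

End HaarMoments.

(** * Reduced states and purities *)

Local Notation glue := Defs.glue.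

Section Supported.
Variable n : nat.
Implicit Types (A B S : {set 'I_n}) (x y z a b c e : config n) (i : 'I_n).

Lemma supportedP A x : reflect (forall i, i \notin A -> x i = false) (x \in supported A).
Proof.
rewrite inE; apply: (iffP forallP) => h i; last by apply/implyP => /h->.
by move=> iA; have := h i; rewrite iA => /negbTE.
Qed.

Definition clip A x : config n := [ffun i => (i \in A) && x i].

Lemma clip_supported A x : clip A x \in supported A.
Proof. by apply/supportedP => i iA; rewrite ffunE (negbTE iA). Qed.

Lemma glueE A a c i : glue A a c i = if i \in A then a i else c i.
Proof. by rewrite ffunE. Qed.

Lemma glue_supported A B a c : c \in supported B ->
  glue A a c \in supported (A :|: B).
Proof.
move=> /supportedP sc; apply/supportedP => i; rewrite inE negb_or => /andP[iA iB].
by rewrite glueE (negbTE iA) sc.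
Qed.

Lemma glue_supported_same A S a c : a \in supported S -> c \in supported S ->
  glue A a c \in supported S.
Proof.
move=> /supportedP sa /supportedP sc; apply/supportedP => i iS.
by rewrite glueE; case: ifP; rewrite ?sa ?sc.
Qed.

Lemma supported_setUC A x : x \in supported (A :|: ~: A).
Proof. by apply/supportedP => i; rewrite !inE orbN. Qed.

Section Sums.
Variable R : comNzRingType.

Lemma sum_supported_prod S (h : 'I_n -> bool -> R) :
  \sum_(z in supported S) \prod_(i in S) h i (z i) =
  \prod_(i in S) \sum_b h i b.
Proof.
rewrite (big_distr_big_dep false (mem S) (fun _ => predT)).
apply: eq_bigl => z; apply/supportedP/pfamilyP => [sz|[sz _] i iS].
  by split=> //; apply/fintype.subsetP => i; rewrite inE; apply: contraNT => /sz ->.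
by apply/eqP; apply: contraNT iS => zi; move/fintype.subsetP: sz; apply; rewrite inE.
Qed.

Lemma sum_glue A B (F : config n -> R) : [disjoint A & B] ->
  \sum_(x in supported (A :|: B)) F x =
  \sum_(e in supported A) \sum_(c in supported B) F (glue A e c).
Proof.
move=> dAB; rewrite pair_big /=.
rewrite (reindex_onto (fun p : config n * config n => glue A p.1 p.2)
  (fun x => (clip A x, clip B x))) /=; last first.
  move=> x /supportedP sx; apply/ffunP => i; rewrite glueE !ffunE.
  case: (boolP (i \in A)) => //= iA; case: (boolP (i \in B)) => //= iB.
  by rewrite sx// inE negb_or iA.
apply: eq_bigl => -[e c] /=; apply/andP/andP => [[_ /eqP[<- <-]]|[se sc]].
  by rewrite !clip_supported.
split; first exact: glue_supported.
apply/eqP; congr pair; apply/ffunP => i; rewrite ffunE glueE.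
  by case: ifP => //= iA; move/supportedP: se => ->//; rewrite iA.
case: (boolP (i \in B)) => iB /=; last by move/supportedP: sc => ->.
by rewrite (disjointFl dAB iB).
Qed.

Lemma prod_eqb S x y : x \in supported S -> y \in supported S ->
  \prod_(i in S) (x i == y i)%:R = (x == y)%:R :> R.
Proof.
move=> /supportedP sx /supportedP sy; case: (eqVneq x y) => [->|xy].
  by rewrite big1// => i _; rewrite eqxx.
have [i xyi] : exists i, x i != y i.
  apply/existsP; apply: contraNT xy; rewrite negb_exists => /forallP h.
  by apply/eqP/ffunP => i; have := h i; rewrite negbK => /eqP.
have iS : i \in S by apply: contraNT xyi => iS; rewrite sx// sy.
by rewrite (bigD1 i)//= (negbTE xyi) mul0r.
Qed.

Lemma sum_delta (D : {set config n}) y (F : config n -> R) : y \in D ->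
  \sum_(x in D) F x * (x == y)%:R = F y.
Proof.
move=> yD; rewrite (bigD1 y)//= eqxx mulr1 big1 ?addr0// => x /andP[_ /negbTE->].
by rewrite mulr0.
Qed.

End Sums.
End Supported.

Section Purity.
Variables (R : realType) (n : nat) (psi : config n -> R[i]).
Implicit Types (A B S : {set 'I_n}) (x y z a b c e : config n) (i : 'I_n).
Local Notation red := (reduced_state psi).

Definition purity_sum A : R[i] :=
  \sum_(a in supported A) \sum_(b in supported A) red A a b * red A b a.

Lemma red_conj A a b : red A b a = conjc (red A a b).
Proof.
by rewrite conjc_sum; apply: eq_bigr => c _; rewrite conjcM conjcK mulrC.
Qed.

Lemma purity_sum_ge0 A : 0 <= purity_sum A.
Proof.
apply: sumr_ge0 => a _; apply: sumr_ge0 => b _.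
by rewrite (red_conj A a b) mulcJ_ge0.
Qed.

Lemma red_subset A S e e' : A \subset S -> red A e e' =
  \sum_(c in supported (S :\: A)) red S (glue A e c) (glue A e' c).
Proof.
move=> AS; rewrite /reduced_state.
have -> : ~: A = (S :\: A) :|: ~: S.
  apply/finset.setP => i; rewrite !inE; case: (boolP (i \in A)) => //= iA.
    by rewrite (fintype.subsetP AS).
  by rewrite orbN.
rewrite sum_glue; last first.
  by rewrite finset.disjoints_subset finset.setCK finset.subsetDl.
apply: eq_bigr => c _; apply: eq_bigr => d' _; congr (psi _ * conjc (psi _)).
  apply/ffunP => i; rewrite !glueE inE.
  by case: (boolP (i \in A)) => //= iA; rewrite (fintype.subsetP AS).
apply/ffunP => i; rewrite !glueE inE.
by case: (boolP (i \in A)) => //= iA; rewrite (fintype.subsetP AS).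
Qed.

Hypothesis psi1 : normalized psi.

Lemma norm_split A :
  \sum_(a in supported A) \sum_(c in supported (~: A))
    psi (glue A a c) * conjc (psi (glue A a c)) = 1.
Proof.
rewrite -(sum_glue (A := A) (B := ~: A) (fun x => psi x * conjc (psi x))); last first.
  by rewrite finset.disjoints_subset finset.setCK.
by rewrite -[RHS]psi1; apply: eq_bigl => x; rewrite supported_setUC.
Qed.

Lemma red_trace A : \sum_(a in supported A) red A a a = 1.
Proof. exact: norm_split. Qed.

Lemma purityE A : purity psi A = purity_sum A.
Proof.
rewrite /purity; case: eqP => // ->.
have s0 : supported (finset.set0 : {set 'I_n}) = [set clip finset.set0 [ffun => false]].
  apply/finset.setP => x; rewrite finset.in_set1; apply/supportedP/eqP => [sx|->].
    by apply/ffunP => i; rewrite ffunE sx ?inE.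
  by move=> i _; rewrite ffunE inE.
have := red_trace finset.set0; rewrite /purity_sum s0 !big_set1 => ->.
by rewrite mulr1.
Qed.

(* Lagrange's identity: [1 - purity] is half of the sum of the
   [|v a c * v b c' - v a c' * v b c| ^ 2], where [v a c = psi (glue A a c)]. *)
Lemma purity_sum_le1 A : purity_sum A <= 1.
Proof.
pose v a c := psi (glue A a c).
pose sA := supported A; pose sB := supported (~: A).
pose T1 a b c c' := (v a c * conjc (v a c)) * (v b c' * conjc (v b c')).
pose T2 a b c c' := (v a c * conjc (v b c)) * (v b c' * conjc (v a c')).
have e1 : \sum_(a in sA) \sum_(b in sA) \sum_(c in sB) \sum_(c' in sB) T1 a b c c' = 1.
  rewrite -[RHS]mulr1 -{1}(norm_split A) -(norm_split A) mulr_suml.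
  apply: eq_bigr => a _; rewrite mulr_sumr; apply: eq_bigr => b _.
  by rewrite mulr_suml; apply: eq_bigr => c _; rewrite mulr_sumr.
have e2 : \sum_(a in sA) \sum_(b in sA) \sum_(c in sB) \sum_(c' in sB) T2 a b c c' =
    purity_sum A.
  apply: eq_bigr => a _; apply: eq_bigr => b _.
  by rewrite mulr_suml; apply: eq_bigr => c _; rewrite mulr_sumr.
pose w a b c c' := v a c * v b c' - v a c' * v b c.
have wE a b c c' : w a b c c' * conjc (w a b c c') =
    T1 a b c c' + T1 a b c' c - (T2 a b c c' + T2 a b c' c).
  by rewrite /w /T1 /T2 rmorphB !rmorphM /=; ring.
have swap (F : config n -> config n -> config n -> config n -> R[i]) :
    \sum_(a in sA) \sum_(b in sA) \sum_(c in sB) \sum_(c' in sB) F a b c' c =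
    \sum_(a in sA) \sum_(b in sA) \sum_(c in sB) \sum_(c' in sB) F a b c c'.
  by apply: eq_bigr => a _; apply: eq_bigr => b _; rewrite exchange_big.
have : 0 <= \sum_(a in sA) \sum_(b in sA) \sum_(c in sB) \sum_(c' in sB)
    w a b c c' * conjc (w a b c c').
  by do 4 (apply: sumr_ge0 => ? _); exact: mulcJ_ge0.
under eq_bigr do under eq_bigr do under eq_bigr do under eq_bigr do rewrite wE.
under eq_bigr do under eq_bigr do under eq_bigr do rewrite sumrB !big_split /=.
under eq_bigr do under eq_bigr do rewrite sumrB !big_split /=.
under eq_bigr do rewrite sumrB !big_split /=.
rewrite sumrB !big_split /= (swap T1) (swap T2) e1 e2 subr_ge0 -!mulr2n.
by rewrite lerMn2r.
Qed.

(* The swap trick: tr((rho_S (x) rho_S) SWAP_A) = tr(rho_A ^ 2). *)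
Lemma sum_swap_purity A S : A \subset S ->
  \sum_(a in supported S) \sum_(b in supported S)
  \sum_(a' in supported S) \sum_(b' in supported S)
    red S a b * red S a' b' *
    \prod_(i in S) (if i \in A then (a i == b' i)%:R * (a' i == b i)%:R
                    else (a i == b i)%:R * (a' i == b' i)%:R) = purity_sum A.
Proof.
move=> AS.
transitivity (\sum_(a in supported S) \sum_(a' in supported S)
    red S a (glue A a' a) * red S a' (glue A a a')).
  apply: eq_bigr => a sa; rewrite exchange_big /=; apply: eq_bigr => a' sa'.
  have s1 : glue A a' a \in supported S by exact: glue_supported_same.
  have s2 : glue A a a' \in supported S by exact: glue_supported_same.
  rewrite -(sum_delta (red S a) s1) mulr_suml; apply: eq_bigr => b sb.
  rewrite -(sum_delta (red S a') s2) mulr_sumr; apply: eq_bigr => b' sb'.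
  rewrite -(prod_eqb R[i] sb s1) -(prod_eqb R[i] sb' s2) mulrACA.
  congr (_ * _); rewrite -big_split /=; apply: eq_bigr => i _.
  by rewrite !glueE (eq_sym (b i)) (eq_sym (b' i)); case: ifP => _; first exact: mulrC.
have US : S = A :|: (S :\: A) by rewrite -[LHS](finset.setID S A) (finset.setIidPr AS).
have dA : [disjoint A & S :\: A].
  by rewrite disjoint_sym finset.disjoints_subset; apply/fintype.subsetP => i; rewrite !inE => /andP[].
have sumS (F : config n -> R[i]) : \sum_(x in supported S) F x =
    \sum_(e in supported A) \sum_(c in supported (S :\: A)) F (glue A e c).
  by rewrite {1}US sum_glue.
rewrite sumS; apply: eq_bigr => e _.
under eq_bigr do rewrite sumS.
rewrite exchange_big /=; apply: eq_bigr => e' _.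
rewrite (red_subset e e' AS) (red_subset e' e AS) mulr_suml.
apply: eq_bigr => c _; rewrite mulr_sumr; apply: eq_bigr => c' _.
by congr (red _ _ _ * red _ _ _); apply/ffunP => i; rewrite !glueE; case: (i \in A).
Qed.

Lemma outcome_probE S (U : 'I_n -> 'M[R[i]]_2) z : z \in supported S ->
  real_complex R (outcome_prob S U psi z) =
  \sum_(a in supported S) \sum_(b in supported S) red S a b *
    \prod_(i in S) (U i (bidx (z i)) (bidx (a i)) *
                    conjc (U i (bidx (z i)) (bidx (b i)))).
Proof.
move=> sz; rewrite /outcome_prob rmorph_sum /=.
rewrite (reindex_onto (glue S z) (clip (~: S))) /=; last first.
  move=> x /forallP xz; apply/ffunP => i; rewrite glueE ffunE inE.
  by case: ifP => //= iS; have := xz i; rewrite iS => /eqP.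
transitivity (\sum_(c in supported (~: S)) \sum_(a in supported S) \sum_(b in supported S)
    psi (glue S a c) * conjc (psi (glue S b c)) *
    \prod_(i in S) (U i (bidx (z i)) (bidx (a i)) *
                    conjc (U i (bidx (z i)) (bidx (b i))))).
  apply: eq_big => [c|c _].
    apply/andP/idP => [[_ /eqP <-]|sc]; first exact: clip_supported.
    split; first by apply/forallP => i; apply/implyP => iS; rewrite glueE iS.
    apply/eqP/ffunP => i; rewrite ffunE glueE inE.
    by case: ifP => //= iS; move/supportedP: sc => -> //; rewrite inE iS.
  have apE : apply_local S U psi (glue S z c) = \sum_(a in supported S)
      (\prod_(i in S) U i (bidx (z i)) (bidx (a i))) * psi (glue S a c).
    apply: eq_bigr => a _; congr (_ * psi _).
      by apply: eq_bigr => i iS; rewrite glueE iS.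
    by apply/ffunP => i; rewrite !glueE; case: (i \in S).
  set X := apply_local _ _ _ _.
  have -> : real_complex R (complex.Re (X * conjc X)) = X * conjc X.
    by rewrite RRe_real// ger0_real ?mulcJ_ge0.
  rewrite /X apE conjc_sum mulr_suml; apply: eq_bigr => a _.
  rewrite mulr_sumr; apply: eq_bigr => b _.
  by rewrite conjcM conjc_prod mulrACA -big_split /= mulrC.
rewrite exchange_big /=; apply: eq_bigr => a _.
by rewrite exchange_big /=; apply: eq_bigr => b _; rewrite -mulr_suml.
Qed.

End Purity.

(** * Failure probability of the protocol *)

Section FiniteSums.
Variable R : comNzRingType.

Lemma sum_pair (A B : finType) (F : A * B -> R) : \sum_p F p = \sum_a \sum_b F (a, b).
Proof. by rewrite pair_bigA; apply: eq_bigr => -[]. Qed.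

Lemma sum_ffun_pair (I A B : finType) (F : {ffun I -> A * B} -> R) :
  \sum_k F k = \sum_(x : {ffun I -> A}) \sum_(y : {ffun I -> B}) F [ffun i => (x i, y i)].
Proof.
rewrite pair_bigA /=.
rewrite (reindex (fun p : {ffun I -> A} * {ffun I -> B} => [ffun i => (p.1 i, p.2 i)])) //.
exists (fun k : {ffun I -> A * B} => ([ffun i => (k i).1], [ffun i => (k i).2])) => [[x y] _|k _].
  by congr pair; apply/ffunP => i; rewrite !ffunE.
by apply/ffunP => i; rewrite !ffunE -surjective_pairing.
Qed.

Lemma sum_ffun_image (I T J : finType) (e : T -> J) (F : {ffun I -> J} -> R) (G : T -> R) :
  \sum_(k : {ffun I -> T}) F [ffun l => e (k l)] * \prod_l G (k l) =
  \sum_(x : {ffun I -> J}) F x * \prod_l \sum_(t | e t == x l) G t.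
Proof.
rewrite (partition_big (fun k : {ffun I -> T} => [ffun l => e (k l)]) xpredT) //=.
apply: eq_bigr => x _.
rewrite (bigA_distr_big_dep (fun l t => e t == x l)) mulr_sumr.
apply: eq_big => [k|k /eqP-> //].
apply/eqP/familyP => [<- l|h]; first by rewrite unfold_in /= ffunE.
by apply/ffunP => l; rewrite ffunE; apply/eqP; exact: h.
Qed.

Lemma prod_add_powerset (I : finType) (S : {set I}) (F G : I -> R) :
  \prod_(i in S) (F i + G i) =
  \sum_(A in powerset S) \prod_(i in S) (if i \in A then F i else G i).
Proof.
transitivity (\prod_i ((if i \in S then F i else 0) + (if i \in S then G i else 1))).
  by rewrite big_mkcond; apply: eq_bigr => i _; case: ifP; rewrite ?add0r.
rewrite bigA_distr /= [RHS]big_mkcond /=.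
apply: eq_big => [A|A _]; first by rewrite inE.
rewrite powersetE; case: ifPn => [AS|].
  rewrite [RHS]big_mkcond; apply: eq_bigr => i _.
  by case: (boolP (i \in S)) => // iS; case: ifP => // /(fintype.subsetP AS); rewrite (negbTE iS).
by case/subsetPn => i iA iS; rewrite (bigD1 i)//= iA (negbTE iS) mul0r.
Qed.

Lemma prod_nat_bool (I : finType) (b : I -> bool) :
  \prod_i (b i)%:R = [forall i, b i]%:R :> R.
Proof.
case: (boolP [forall i, b i]) => [/forallP h|].
  by rewrite big1// => i _; rewrite h.
by rewrite negb_forall => /existsP[i /negbTE bi]; rewrite (bigD1 i)//= bi mul0r.
Qed.

End FiniteSums.

Section Assembly.
Context {R : realType} {d : measure_display} {G : measurableType d}.
Variables (mu : probability G R) (g : G -> 'M[R[i]]_2) (n : nat).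
Variables (psi : config n -> R[i]) (S : {set 'I_n}).
Hypotheses (haar_g : haar_random mu g) (psi1 : normalized psi).

Let Z := config n.
Let Q := ((Z * Z) * (Z * Z))%type.
Let sup : {set Z} := supported S.
Local Notation red := (reduced_state psi S).

Definition quad_weight (q : Q) : R[i] :=
  [&& q.1.1 \in sup, q.1.2 \in sup, q.2.1 \in sup & q.2.2 \in sup]%:R *
  (red q.1.1 q.1.2 * red q.2.1 q.2.2).

Definition local_term (V : 'M[R[i]]_2) (x y : bool) (q : Q) (i : 'I_n) : R[i] :=
  quartic V (bidx x) (bidx (q.1.1 i)) (bidx x) (bidx (q.1.2 i))
            (bidx y) (bidx (q.2.1 i)) (bidx y) (bidx (q.2.2 i)).

Definition local_moment (x y : bool) (q : Q) (i : 'I_n) : R[i] :=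
  cmean mu (fun w => local_term (g w) x y q i).

Lemma local_momentE x y q i : local_moment x y q i =
  haar_moment mu g (bidx x) (bidx (q.1.1 i)) (bidx x) (bidx (q.1.2 i))
                   (bidx y) (bidx (q.2.1 i)) (bidx y) (bidx (q.2.2 i)).
Proof. by []. Qed.

Lemma sum_quad_weight (F : Q -> R[i]) : \sum_q quad_weight q * F q =
  \sum_(a in sup) \sum_(b in sup) \sum_(a' in sup) \sum_(b' in sup)
    red a b * red a' b' * F ((a, b), (a', b')).
Proof.
rewrite !sum_pair.
rewrite [RHS]big_mkcond; apply: eq_bigr => a _; rewrite /quad_weight /=.
case: ifP => sa /=; last by rewrite big1// => b _; rewrite big1// => p _; rewrite !mul0r.
rewrite [RHS]big_mkcond; apply: eq_bigr => b _.
case: ifP => sb /=; last by rewrite big1// => p _; rewrite !mul0r.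
rewrite sum_pair /= [RHS]big_mkcond; apply: eq_bigr => a' _.
case: ifP => sa' /=; last by rewrite big1// => b' _; rewrite !mul0r.
rewrite [RHS]big_mkcond; apply: eq_bigr => b' _.
by case: ifP => sb' /=; rewrite ?mul0r ?mul1r.
Qed.

Lemma outcome_prob_mul (U : 'I_n -> 'M[R[i]]_2) z z' : z \in sup -> z' \in sup ->
  real_complex R (outcome_prob S U psi z * outcome_prob S U psi z') =
  \sum_q quad_weight q * \prod_(i in S) local_term (U i) (z i) (z' i) q i.
Proof.
move=> sz sz'; rewrite sum_quad_weight rmorphM /= !outcome_probE// mulr_suml.
apply: eq_bigr => a _; rewrite mulr_suml; apply: eq_bigr => b _.
rewrite mulr_sumr; apply: eq_bigr => a' _; rewrite mulr_sumr; apply: eq_bigr => b' _.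
by rewrite mulrACA -big_split.
Qed.

Lemma bidx_eq b b' : (bidx b == bidx b') = (b == b').
Proof. by case: b; case: b'. Qed.

Lemma sum_local_moment q i : \sum_b \sum_b' local_moment b b' q i =
  (q.1.1 i == q.1.2 i)%:R * (q.2.1 i == q.2.2 i)%:R.
Proof.
rewrite -!bidx_eq -(haar_moment_trace haar_g) !sum2E !big_bool /=.
by rewrite addrC; congr (_ + _); rewrite addrC.
Qed.

Lemma sum_local_moment_diag q i : \sum_b local_moment b b q i =
  ((q.1.1 i == q.2.2 i)%:R * (q.2.1 i == q.1.2 i)%:R +
   (q.1.1 i == q.1.2 i)%:R * (q.2.1 i == q.2.2 i)%:R) / 3.
Proof.
rewrite big_bool /= !local_momentE !(haar_moment_row haar_g) !bidx_eq.
by field.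
Qed.

Let Samp := ((Z * Z) * Q)%type.

Definition sample_weight (t : Samp) : R[i] :=
  ((t.1.1 \in sup) && (t.1.2 \in sup))%:R * quad_weight t.2.

Definition sample_moment (t : Samp) : R[i] :=
  sample_weight t * \prod_(i in S) local_moment (t.1.1 i) (t.1.2 i) t.2 i.

Lemma sum_sample (F : Z -> Z -> Q -> R[i]) :
  \sum_(t : Samp) sample_weight t * F t.1.1 t.1.2 t.2 =
  \sum_q quad_weight q * \sum_(z in sup) \sum_(z' in sup) F z z' q.
Proof.
rewrite sum_pair exchange_big /=; apply: eq_bigr => q _.
rewrite sum_pair /= mulr_sumr [RHS]big_mkcond; apply: eq_bigr => z _; rewrite /sample_weight /=.
case: ifP => sz /=; last by rewrite big1// => z' _; rewrite !mul0r.
rewrite mulr_sumr [RHS]big_mkcond; apply: eq_bigr => z' _.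
by case: ifP; rewrite ?mul0r ?mul1r.
Qed.


Definition collision_prob : R :=
  (3 ^+ #|S|)^-1 * \sum_(A in powerset S) complex.Re (purity psi A).

Lemma real_purity A : real_complex R (complex.Re (purity psi A)) = purity_sum psi A.
Proof. by rewrite purityE// RRe_real// ger0_real// purity_sum_ge0. Qed.

Lemma purity_sum0 : purity_sum psi finset.set0 = 1.
Proof. by rewrite -purityE// /purity eqxx. Qed.

Lemma sample_moment_total : \sum_t sample_moment t = 1.
Proof.
rewrite (sum_sample (fun z z' q => \prod_(i in S) local_moment (z i) (z' i) q i)).
transitivity (purity_sum psi finset.set0); last exact: purity_sum0.
rewrite -(sum_swap_purity psi (finset.sub0set S)).
have -> : \sum_(a in supported S) \sum_(b in supported S)
  \sum_(a' in supported S) \sum_(b' in supported S)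
    red a b * red a' b' *
    \prod_(i in S) (if i \in (finset.set0 : {set 'I_n}) then (a i == b' i)%:R * (a' i == b i)%:R
                    else (a i == b i)%:R * (a' i == b' i)%:R) =
  \sum_q quad_weight q * \prod_(i in S) ((q.1.1 i == q.1.2 i)%:R * (q.2.1 i == q.2.2 i)%:R).
  rewrite sum_quad_weight; do 4 (apply: eq_bigr => ? _); congr (_ * _).
  by apply: eq_bigr => i _; rewrite inE.
apply: eq_bigr => q _; congr (_ * _).
under [RHS]eq_bigr do rewrite -sum_local_moment.
rewrite -(sum_supported_prod S (fun i b => \sum_b' local_moment b b' q i)).
apply: eq_bigr => z _.
exact: (sum_supported_prod S (fun i b' => local_moment (z i) b' q i)).
Qed.

Lemma sample_moment_collision :
  \sum_(t : Samp | t.1.1 == t.1.2) sample_moment t = real_complex R collision_prob.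
Proof.
transitivity (\sum_q quad_weight q *
    \prod_(i in S) \sum_b local_moment b b q i).
  pose F (z z' : Z) q : R[i] :=
    (\prod_(i in S) local_moment (z i) (z' i) q i) * (z' == z)%:R.
  transitivity (\sum_(t : Samp) sample_weight t * F t.1.1 t.1.2 t.2).
    rewrite big_mkcond /=; apply: eq_bigr => t _; rewrite /F eq_sym mulrA.
    by case: ifP; rewrite ?mulr1 ?mulr0.
  rewrite (sum_sample F); apply: eq_bigr => q _; congr (_ * _).
  rewrite -(sum_supported_prod S (fun i b => local_moment b b q i)).
  apply: eq_bigr => z sz.
  exact: (sum_delta (fun z' => \prod_(i in S) local_moment (z i) (z' i) q i) sz).
rewrite /collision_prob rmorphM /= fmorphV rmorphXn /= rmorph_nat rmorph_sum /=.
under [in RHS]eq_bigr do rewrite real_purity.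
under eq_bigr => q _.
  under eq_bigr do rewrite sum_local_moment_diag.
  rewrite big_split /= prodr_const exprVn prod_add_powerset mulrA mulr_sumr mulr_suml.
  over.
rewrite exchange_big /= mulr_sumr; apply: eq_bigr => A.
rewrite powersetE => AS; rewrite -(sum_swap_purity psi AS).
rewrite -mulr_suml sum_quad_weight mulrC; congr (_ * _).
Qed.

Lemma sample_moment_bern b :
  \sum_(t : Samp | (t.1.1 == t.1.2) == b) sample_moment t =
  real_complex R (bern collision_prob b).
Proof.
case: b => /=.
  by rewrite -sample_moment_collision; apply: eq_bigl => t; rewrite eqb_id.
have := sample_moment_total.
rewrite (bigID (fun t : Samp => t.1.1 == t.1.2)) /= sample_moment_collision => tot.
rewrite rmorphB rmorph1 -tot [in RHS]addrAC subrr add0r.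
by apply: eq_bigl => t; rewrite eqbF_neg.
Qed.

Lemma collision_prob_ge0 : 0 <= collision_prob.
Proof.
rewrite /collision_prob mulr_ge0 ?invr_ge0 ?exprn_ge0//.
apply: sumr_ge0 => A _; rewrite -ler0c real_purity; exact: purity_sum_ge0.
Qed.

Lemma collision_probM : (3 / 2) ^+ #|S| * collision_prob =
  (2 ^+ #|S|)^-1 * \sum_(A in powerset S) complex.Re (purity psi A).
Proof.
by rewrite mulrA; congr (_ * _); rewrite expr_div_n mulrAC divff ?mul1r// expf_neq0.
Qed.

Lemma collision_prob_le1 : (3 / 2) ^+ #|S| * collision_prob <= 1.
Proof.
rewrite collision_probM mulrC ler_pdivrMr ?exprn_gt0// mul1r.
apply: (@le_trans _ _ (\sum_(A in powerset S) 1)).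
  by apply: ler_sum => A _; rewrite -lecR real_purity; exact: purity_sum_le1.
by rewrite sumr_const card_powerset natrX.
Qed.

Lemma conc_entE : conc_ent psi S = 1 - (3 / 2) ^+ #|S| * collision_prob.
Proof. by rewrite collision_probM. Qed.

Variables eps delta : R.
Let L := Lsz S eps delta.

Definition fails (x : {ffun 'I_L -> bool}) : bool :=
  eps <= `|median [seq block_est R #|S| (Bsz #|S| eps) x b | b <- iota 0 (NB delta)]
           - conc_ent psi S|.

Lemma cond_failureE (u : 'I_L * 'I_n -> G) :
  real_complex R (cond_failure g psi u) =
  \sum_(k : {ffun 'I_L -> Samp}) (fails [ffun l => (k l).1.1 == (k l).1.2])%:R *
    \prod_l (sample_weight (k l) *
      \prod_(i in S) local_term (g (u (l, i))) ((k l).1.1 i) ((k l).1.2 i) (k l).2 i).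
Proof.
rewrite sum_ffun_pair sum_ffun_pair rmorph_sum /= big_mkcond /=.
apply: eq_bigr => z1 _; rewrite rmorph_sum /=.
pose T (z2 : {ffun 'I_L -> Z}) l := \sum_q quad_weight q *
  \prod_(i in S) local_term (g (u (l, i))) (z1 l i) (z2 l i) q i.
transitivity (\sum_(z2 : {ffun 'I_L -> Z}) (fails [ffun l => z1 l == z2 l])%:R *
  ([forall l, z1 l \in sup]%:R * [forall l, z2 l \in sup]%:R * \prod_l T z2 l) : R[i]).
  case: ifPn => [/forallP s1|s1]; last first.
    by rewrite big1// => z2 _; rewrite !mul0r mulr0.
  rewrite big_mkcond; apply: eq_bigr => z2 _.
  case: ifPn => [/forallP s2|s2]; last by rewrite mulr0 mul0r mulr0.
  rewrite !mul1r rmorphM rmorph_prod /= mulrC; congr (_ * _).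
    rewrite rmorph_nat /fails /mom_estimate; congr ((nat_of_bool (_ <= `|median _ - _|))%:R).
    apply: eq_map => b; rewrite /block_est; congr (_ - _ * _).
    by apply: eq_bigr => l _; rewrite ffunE.
  by apply: eq_bigr => l _; rewrite outcome_prob_mul.
apply: eq_bigr => z2 _.
rewrite -!prod_nat_bool -!big_split /= /T.
rewrite (eq_bigr (fun l => \sum_q ((z1 l \in sup)%:R * (z2 l \in sup)%:R) * (quad_weight q *
  \prod_(i in S) local_term (g (u (l, i))) (z1 l i) (z2 l i) q i))); last first.
  by move=> l _; rewrite mulr_sumr.
rewrite bigA_distr_bigA mulr_sumr; apply: eq_bigr => q _.
congr (_ * _).
  by congr ((nat_of_bool (fails _))%:R); apply/ffunP => l; rewrite !ffunE.
apply: eq_bigr => l _; rewrite !ffunE /sample_weight /= mulrA.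
by rewrite -natrM mulnb.
Qed.

Lemma failure_probE :
  failure_prob mu g psi S eps delta =
  (\sum_(x : {ffun 'I_L -> bool}) (\prod_l bern collision_prob (x l)) * (fails x)%:R)%:E.
Proof.
pose c (k : {ffun 'I_L -> Samp}) : R[i] :=
  (fails [ffun l => (k l).1.1 == (k l).1.2])%:R * \prod_l sample_weight (k l).
pose f (k : {ffun 'I_L -> Samp}) (p : 'I_L * 'I_n) (w : G) : R[i] :=
  local_term (g w) ((k p.1).1.1 p.2) ((k p.1).1.2 p.2) (k p.1).2 p.2.
pose r := [seq (l, i) | l <- enum 'I_L, i <- enum S].
have prodr (F : 'I_L * 'I_n -> R[i]) :
    \prod_(p <- r) F p = \prod_l \prod_(i in S) F (l, i).
  rewrite big_allpairs_dep big_enum; apply: eq_bigr => l _.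
  by rewrite big_enum.
have split_c (F : {ffun 'I_L -> Samp} -> 'I_L -> 'I_n -> R[i]) :
    \sum_k c k * \prod_l \prod_(i in S) F k l i =
    \sum_(k : {ffun 'I_L -> Samp}) (fails [ffun l => (k l).1.1 == (k l).1.2])%:R *
      \prod_l (sample_weight (k l) * \prod_(i in S) F k l i).
  by apply: eq_bigr => k _; rewrite /c [in RHS]big_split /= mulrA.
have -> : failure_prob mu g psi S eps delta = iter_int mu r (fun u =>
    (complex.Re (\sum_k c k * \prod_(p <- r) f k p (u p)))%:E) (fun=> point).
  apply: eq_iter_int => u _; congr EFin.
  rewrite -[LHS]/(complex.Re (real_complex R (cond_failure g psi u))).
  rewrite cond_failureE -(split_c (fun k l i => f k (l, i) (u (l, i)))).
  by congr complex.Re; apply: eq_bigr => k _; rewrite prodr.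
rewrite iter_int_sum_prod; first 1 last.
- by move=> k p; exact: (cbmeas_quartic haar_g).
- by apply: allpairs_uniq => [||[? ?] [? ?]]; rewrite ?enum_uniq.
congr EFin.
under eq_bigr do rewrite prodr.
rewrite (split_c (fun k l i => cmean mu (f k (l, i)))).
rewrite (sum_ffun_image (fun t : Samp => t.1.1 == t.1.2) (fun x => (fails x)%:R) sample_moment).
under eq_bigr do under eq_bigr do rewrite sample_moment_bern.
rewrite -[RHS]/(complex.Re (real_complex R _)) rmorph_sum; congr complex.Re.
by apply: eq_bigr => x _; rewrite rmorphM rmorph_prod /= rmorph_nat mulrC.
Qed.

End Assembly.

Theorem theorem2 (R : realType) (d : measure_display) (G : measurableType d)
    (mu : probability G R) (g : G -> 'M[R[i]]_2)
    (n : nat) (psi : config n -> R[i]) (S : {set 'I_n}) (eps delta : R) :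
  haar_random mu g ->
  normalized psi ->
  S != finset.set0 ->
  0 < eps ->
  0 < 1 - delta < 1 ->
  (failure_prob mu g psi S eps delta <= delta%:E)%E.
Proof.
move=> haar_g psi1 _ e0 d01; rewrite failure_probE// lee_fin /fails conc_entE//.
apply: median_of_means_bound => //.
- by move: d01; lra.
- exact: collision_prob_ge0.
- exact: collision_prob_le1.
Qed.
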